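(* Let $f(x_1,\dots,x_n)=\sum_{i_1=0}^{d_1}\cdots\sum_{i_n=0}^{d_n} c_{i_1,\dots,i_n}\,x_1^{i_1}\cdots x_n^{i_n}$ be a polynomial with real coefficients such that there is no complex solution $(z_1,\dots,z_n)\in\mathbb{C}^n$ of $f(z_1,\dots,z_n)=0$ with $\Re(z_k)\ge 0$ for all $k=1,\dots,n$. Then all the coefficients $c_{i_1,\dots,i_n}$ of $f$ are of the same sign.
   Context: $\Re(z)$ denotes the real part of $z$. ''All coefficients are of the same sign'' means that there are no sign changes among the coefficients: either all $c_{i_1,\dots,i_n}\ge 0$ or all $c_{i_1,\dots,i_n}\le 0$ (zero coefficients are allowed). *)

(* Defs.v *)
From mathcomp Require Export all_boot all_order all_algebra.
From mathcomp Require Export reals.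
From mathcomp Require Export complex mpoly.

Set Implicit Arguments.
Unset Strict Implicit.
Unset Printing Implicit Defensive.

Import Order.TTheory GRing.Theory Num.Theory.
Local Open Scope ring_scope.

(* The value at a complex point of a polynomial with real coefficients. *)
Definition ceval (R : realType) (n : nat) (f : {mpoly R[n]})
    (z : 'I_n -> R[i]) : R[i] :=
  (map_mpoly (real_complex R) f).@[z].

(* f@_m is 0 for multi-exponents m outside the support, so quantifying over all
   m covers any bounding box of exponents. *)
Definition coeffs_same_sign (R : realType) (n : nat) (f : {mpoly R[n]}) : Prop :=
  (forall m : 'X_{1..n}, 0 <= f@_m) \/ (forall m : 'X_{1..n}, f@_m <= 0).

(* Main.v *)
(* For Re t >= 0 and a root r with Re r < 0, 1 / (t - r) has nonnegative real
   part, so d_i g / g has nonnegative real part on the closed right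
   half-spaces whenever g has no zero there. Hence d_i g + e g has no zero
   there either, for every e > 0, and its value at 0 has the sign of g(0).
   Iterating and letting e tend to 0, every iterated derivative of f at 0, i.e.
   every coefficient up to a factorial, has weakly the sign of f(0). *)
Require Import Defs.
From mathcomp Require Import all_boot all_order all_algebra.
From mathcomp Require Import reals.
From mathcomp Require Import complex mpoly.
From mathcomp Require Import ring lra.

Import Order.TTheory GRing.Theory Num.Theory.
Local Open Scope ring_scope.

Section Slice.
Context {K : comNzRingType} {n : nat} (i : 'I_n) (z : 'I_n -> K).

Definition slice_vars (j : 'I_n) : {poly K} := if j == i then 'X else (z j)%:P.

(** Freezing every coordinate of [z] but the [i]-th yields a univariate polynomial, which splits
    over the complex numbers. *)
Definition slice (p : {mpoly K[n]}) : {poly K} := mmap polyC slice_vars p.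

Lemma horner_slice (p : {mpoly K[n]}) (t : K) :
  (slice p).[t] = p.@[fun j => if j == i then t else z j].
Proof.
rewrite /slice /meval /mmap horner_sum; apply: eq_bigr => m _.
rewrite hornerM hornerC /mmap1 horner_prod; congr (_ * _).
apply: eq_bigr => j _; rewrite horner_exp /slice_vars.
by case: eqP => _; rewrite ?hornerX ?hornerC.
Qed.

Lemma horner_slice_id (p : {mpoly K[n]}) : (slice p).[z i] = p.@[z].
Proof. by rewrite horner_slice; apply: meval_eq => j; case: eqP => [->|]. Qed.

Lemma deriv_slice (p : {mpoly K[n]}) : (slice p)^`() = slice p^`M(i).
Proof.
have sliceX (m : 'X_{1..n}) :
    slice 'X_[m] = (\prod_(j < n | j != i) (z j) ^+ m j)%:P * 'X^(m i).
  rewrite /slice mmapX /mmap1 (bigD1 i) //= /slice_vars eqxx mulrC.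
  rewrite rmorph_prod; congr (_ * _); apply: eq_bigr => j /negPf ->.
  by rewrite rmorphXn.
have sliceZ c q : slice (c *: q) = c *: slice q.
  by rewrite /slice mmapZ mul_polyC.
have sliceD q1 q2 : slice (q1 + q2) = slice q1 + slice q2.
  by rewrite /slice raddfD.
elim/mpolyind: p => [|c m p _ _ IH].
  by rewrite /slice mderiv0 mmap0 deriv0.
rewrite mderivD !sliceD derivD IH; congr (_ + _).
rewrite mderivZ !sliceZ derivZ; congr (_ *: _).
(* Both sides truncate the exponent [m i - 1] at 0 and carry the factor [m i], so [m i = 0] needs no
   separate case. *)
rewrite mderivX sliceZ !sliceX derivM derivC mul0r add0r derivXn.
rewrite scaler_nat mnmBE mnm1E eqxx subn1 -mulrnAr; congr (_%:P * _).
apply: eq_bigr => j /negPf ji.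
by rewrite mnmBE mnm1E eq_sym ji subn0.
Qed.

End Slice.

Section Stability.
Context {R : realType}.

(** For [w = a + ib] the real part is [a / (a^2 + b^2)]; the convention that 0 has inverse 0 covers
    [w = 0]. *)
Lemma Re_inv_ge0 (w : R[i]) : 0 <= complex.Re w -> 0 <= complex.Re w^-1.
Proof.
case: w => a b /= a0.
by rewrite divr_ge0 // addr_ge0 // sqr_ge0.
Qed.

Lemma Re_logderiv_ge0 (p : {poly R[i]}) :
  (forall t, 0 <= complex.Re t -> p.[t] != 0) ->
  forall t, 0 <= complex.Re t -> 0 <= complex.Re (p^`().[t] / p.[t]).
Proof.
move=> p_n0 t t0.
have [rs Dp] := closed_field_poly_normal p.
have c0 : lead_coef p != 0.
  by apply: contra (p_n0 t t0); rewrite lead_coef_eq0 => /eqP ->; rewrite horner0.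
have rs_lt0 : forall r, r \in rs -> complex.Re r < 0.
  move=> r r_rs; rewrite ltNge; apply/negP => /p_n0 /negP; apply.
  by rewrite Dp hornerZ mulf_eq0 (negPf c0) -rootE root_prod_XsubC.
(* The leading coefficient cancels; by induction on the roots the quotient is the sum of
   [1 / (t - r)]. *)
rewrite Dp derivZ !hornerZ -mulf_div divff // mul1r.
elim: rs rs_lt0 {Dp} => [|r rs IH] rs_lt0.
  by rewrite big_nil derivC horner0 mul0r.
rewrite big_cons derivM derivXsubC mul1r hornerD !hornerM hornerXsubC.
have Rerr : complex.Re (t - r) = complex.Re t - complex.Re r.
  by case: (t) (r) => [? ?] [? ?].
have rlt0 := rs_lt0 r (mem_head _ _).
have tr0 : t - r != 0.
  by apply/eqP => tr; move: Rerr; rewrite tr /=; lra.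
have P0 : (\prod_(j <- rs) ('X - j%:P)).[t] != 0.
  rewrite -rootE root_prod_XsubC; apply/negP => t_rs.
  by have := rs_lt0 t; rewrite inE t_rs orbT ltNge t0 => /(_ isT).
set P := \prod_(j <- rs) _ in P0 IH *.
have -> : (P.[t] + (t - r) * P^`().[t]) / ((t - r) * P.[t])
          = (t - r)^-1 + P^`().[t] / P.[t].
  by field; rewrite P0 tr0.
rewrite raddfD addr_ge0 //; last first.
  by apply: IH => s s_rs; apply: rs_lt0; rewrite inE s_rs orbT.
by apply: Re_inv_ge0; rewrite Rerr; lra.
Qed.

Context {n : nat}.
Implicit Types (g : {mpoly R[n]}) (m : 'X_{1..n}).

Definition stable g := forall z : 'I_n -> R[i],
  (forall k, 0 <= complex.Re (z k)) -> ceval g z != 0.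

Lemma ceval_mderiv i g z :
  ceval g^`M(i) z = (map_mpoly (real_complex R) g)^`M(i).@[z].
Proof.
congr (_.@[z]); apply/mpolyP => m.
by rewrite mcoeff_map_mpoly !mcoeff_deriv mcoeff_map_mpoly raddfMn.
Qed.

Lemma ceval0 g : ceval g (fun=> 0) = (g@_0)%:C%C.
Proof.
rewrite -mcoeff_map_mpoly /ceval; set h := map_mpoly _ _.
elim/mpolyind: h => [|c m p _ _ IH]; first by rewrite meval0 mcoeff0.
rewrite mevalD mevalZ mcoeffD mcoeffZ IH; congr (_ * _ + _).
rewrite mevalX mcoeffX; have [->|m0] := eqVneq m 0%MM.
  by rewrite big1 // => j _; rewrite mnm0E expr0.
have /forallPn [j mj] : ~~ [forall j, m j == 0%N].
  by apply: contra m0 => /forallP m0; apply/eqP/mnmP => j; rewrite mnm0E; apply/eqP.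
by rewrite (bigD1 j) //= expr0n (negPf mj) mul0r.
Qed.

(** Moving only the [i]-th coordinate within the right half-plane keeps the point in the domain of
    stability, so the slice satisfies the univariate lemma. *)
Lemma Re_mderiv_ge0 i g : stable g -> forall z : 'I_n -> R[i],
  (forall k, 0 <= complex.Re (z k)) ->
  0 <= complex.Re (ceval g^`M(i) z / ceval g z).
Proof.
move=> g_st z z0; rewrite ceval_mderiv /ceval.
rewrite -!(horner_slice_id i z) -deriv_slice.
apply: Re_logderiv_ge0 => // t t0; rewrite horner_slice.
by apply: g_st => k; case: eqP.
Qed.

(** The plain derivative may vanish, even identically; adding [e *: g] raises the real part of the
    quotient by [g] to at least [e], so the step can be iterated. *)
Definition pderiv (e : R) i g : {mpoly R[n]} := g^`M(i) + e *: g.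

Lemma stable_pderiv (e : R) i g : 0 < e -> stable g -> stable (pderiv e i g).
Proof.
move=> e0 g_st z z0; have gz := g_st z z0.
have := Re_mderiv_ge0 i _ g_st z z0.
have -> : ceval (pderiv e i g) z
        = (ceval g^`M(i) z / ceval g z + e%:C%C) * ceval g z.
  rewrite mulrDl divfK // /ceval /pderiv raddfD /= map_mpolyZ.
  by rewrite mevalD mevalZ.
move=> q0; rewrite mulf_neq0 //; apply/eqP => /(congr1 (@complex.Re R)).
by rewrite raddfD /=; lra.
Qed.

Lemma mcoeff0_pderiv_gt0 (e : R) i g :
  0 < e -> stable g -> 0 < g@_0 -> 0 < (pderiv e i g)@_0.
Proof.
move=> e0 g_st g0; have := Re_mderiv_ge0 i _ g_st (fun=> 0) (fun=> lexx 0).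
(* At the origin both values are real, so the bound on the real part bounds the quotient itself. *)
rewrite !ceval0 -fmorph_div /= => q0.
rewrite mcoeffD mcoeffZ ltr_wpDl ?mulr_gt0 //.
by rewrite -(divfK (lt0r_neq0 g0) (g^`M(i)@_0)) mulr_ge0 // ltW.
Qed.

(** This replaces the limit as [e] tends to 0: [B] does not depend on [e]. All [m] are treated at
    once because differentiating reads the coefficient at [m + U_(i)]. *)
Lemma mcoeff_pderiv_approx (s : seq 'I_n) g m :
  exists2 B : R, 0 <= B & forall e, 0 < e -> e <= 1 ->
    `|(foldr (pderiv e) g s)@_m - (foldr (@mderiv n R) g s)@_m| <= e * B.
Proof.
elim: s m => [|i s IH] m /=.
  by exists 0 => // e _ _; rewrite subrr normr0 mulr0.
have [B1 B10 H1] := IH (m + U_(i))%MM; have [B2 B20 H2] := IH m.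
set D := foldr (@mderiv n R) g s in H1 H2 *.
(* The first term is the earlier error scaled by differentiation; the second bounds the coefficient
   that [e] multiplies, using [e <= 1]. *)
exists (B1 *+ (m i).+1 + (`|D@_m| + B2)).
  by rewrite !addr_ge0 // mulrn_wge0.
move=> e e0 e1; rewrite mcoeffD mcoeffZ !mcoeff_deriv.
rewrite addrAC -mulrnBl (le_trans (ler_normD _ _)) // mulrDr lerD //.
  by rewrite normrMn mulrnAr lerMn2r H1.
rewrite normrM gtr0_norm // ler_wpM2l ?(ltW e0) //.
have := H2 _ e0 e1; set F := foldr _ _ _ => H.
rewrite -[F@_m](subrK D@_m) addrC (le_trans (ler_normD _ _)) // lerD //.
by rewrite (le_trans H) // ler_piMl.
Qed.

Lemma stable_mcoeff_ge0 g : stable g -> 0 < g@_0 -> forall m, 0 <= g@_m.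
Proof.
move=> g_st g0 m.
have pos e (s : seq 'I_n) : 0 < e ->
    stable (foldr (pderiv e) g s) /\ 0 < (foldr (pderiv e) g s)@_0.
  move=> e0; elim: s => [|i s [IH1 IH2]]; first by split.
  split; first exact: stable_pderiv e0 IH1.
  exact: mcoeff0_pderiv_gt0 e0 IH1 IH2.
(* This constant term is [g@_m] times a positive product of factorials. *)
have : 0 <= g^`M[m]@_0.
  rewrite mderivm_foldr; set s := flatten _.
  have [B B0 HB] := mcoeff_pderiv_approx s g 0%MM.
  rewrite leNgt; apply/negP; set x := (foldr _ _ _)@_0 in HB * => x0.
  (* This gives [e * B < - x], so the perturbed value, within [e * B] of [x < 0], would be negative.
     The [+ 1] keeps the denominator positive when [B = 0]. *)
  pose e := Num.min 1 (- x / (B + 1)).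
  have e0 : 0 < e by rewrite lt_min ltr01 divr_gt0 ?oppr_gt0 // ltr_wpDl.
  have e1 : e <= 1 by rewrite ge_min lexx.
  have eB : e * (B + 1) <= - x.
    by rewrite -ler_pdivlMr ?ltr_wpDl // ge_min lexx orbT.
  have [_ y0] := pos e s e0.
  have := HB e e0 e1; rewrite ler_norml => /andP[_].
  move: y0 eB; rewrite mulrDr mulr1; move: (_@_0) (e * B) => y eB; lra.
rewrite mcoeff_mderivm addm0 pmulrn_lge0 // prodn_gt0 // => j.
by rewrite ffact_gt0.
Qed.

End Stability.

Theorem theorem4p2 (R : realType) (n : nat) (f : {mpoly R[n]})
    (hf : ~ exists z : 'I_n -> R[i],
        ceval f z = 0 /\ (forall k : 'I_n, 0 <= complex.Re (z k))) :
  coeffs_same_sign f.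
Proof.
have f_st : stable f.
  by move=> z z0; apply/eqP => fz; apply: hf; exists z.
(* The origin lies in the closed right half-space; the sign of f there selects the alternative. *)
have : f@_0 != 0.
  have := f_st (fun=> 0) (fun=> lexx 0).
  by apply: contra => /eqP f0; rewrite ceval0 f0.
rewrite neq_lt => /orP[f0|f0]; [right | left]; last exact: stable_mcoeff_ge0.
move=> m; rewrite -oppr_ge0 -mcoeffN; apply: stable_mcoeff_ge0.
  by move=> z z0; rewrite /ceval raddfN /= mevalN oppr_eq0; apply: f_st.
by rewrite mcoeffN oppr_gt0.
Qed.
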